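(* Let $c,m,n$ be positive integers with $m\le n$. Then: (1) $L_{c,m,n}$ is a multiple of the rational number \[\frac{\prod_{k=m}^{n}(k^2+c)}{c\cdot(n-m)!\prod_{k=1}^{n-m}(k^2+4c)};\] (2) $L_{c,m,n}\ge \lambda_1(c)\cdot m^2\dfrac{n!^2}{m!^2(n-m)!^3}$, where $\lambda_1(c):=e^{-\frac{2\pi^2}{3}c}/c$.
   Context: $L_{c,m,n}:=\mathrm{lcm}\{m^2+c,(m+1)^2+c,\dots,n^2+c\}$. An integer $a$ is said to be a multiple of a nonzero rational number $r$ if $a/r$ is an integer. An empty product equals $1$. *)

(* Defs.v *)
From HB Require Import structures.
From mathcomp Require Import all_boot all_order all_algebra.
From mathcomp Require Import reals sequences exp trigo.
Set Implicit Arguments.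
Unset Strict Implicit.
Unset Printing Implicit Defensive.
Import Order.TTheory GRing.Theory Num.Theory.
Local Open Scope ring_scope.

Definition lcm_quad (c m n : nat) : nat :=
  \big[lcmn/1%N]_(m <= k < n.+1) (k ^ 2 + c)%N.

(* The conjunct [r != 0] is needed because [a / 0 = 0] in MathComp. *)
Definition multiple_of_rat (a : int) (r : rat) : Prop :=
  r != 0 /\ a%:~R / r \is a Num.int.

Definition lambda1 (R : realType) (c : nat) : R :=
  expR (- (2 * pi ^+ 2 / 3) * c%:R) / c%:R.

(* Main.v *)
Require Import Defs.
From HB Require Import structures.
From mathcomp Require Import all_boot all_order all_algebra.
From mathcomp Require Import reals sequences exp trigo.
From mathcomp Require Import normedtype topology derive.
From mathcomp Require Import ring lra zify.
Set Implicit Arguments.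
Unset Strict Implicit.
Unset Printing Implicit Defensive.
Import Order.TTheory GRing.Theory Num.Theory.
Local Open Scope ring_scope.

(** Write [f k = k ^ 2 + c] and let [L] be a common multiple of [f m, ..., f n],
    with [d = n - m].  The product of all the [f k] divides
    [L * (d`! * \prod_(1 <= k <= d) (k ^ 2 + 4 * c))] by induction on [d]: the
    new factor [d * (d ^ 2 + 4 * c)] is an integer combination of [f m] and
    [f n], and [f m] (resp. [f n]) times the product over the window without
    [m] (resp. [n]) is the whole product.
    For (2), [\prod (1 + 4 * c / k ^ 2)] is bounded
    by splitting off its first factor and telescoping the rest; the loss against
    Euler's value of the sum of [1 / k ^ 2] is small enough that
    [8 <= pi ^+ 2] suffices. *)

Lemma prod_quad_dvd (c L N m : nat) :
  (forall k, m <= k <= m + N -> k ^ 2 + c %| L)%N ->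
  (\prod_(m <= k < (m + N).+1) (k ^ 2 + c)
     %| L * (N`! * \prod_(1 <= k < N.+1) (k ^ 2 + 4 * c)))%N.
Proof.
elim: N m => [|N IHN] m dvdL.
  by rewrite addn0 big_nat1 big_geq // !muln1 dvdL // addn0 leqnn.
have dvd1 := IHN m (fun k hk => dvdL k ltac:(lia)).
have dvd2 := IHN m.+1 (fun k hk => dvdL k ltac:(lia)).
rewrite factS (big_nat_recr N.+1) //=.
set M := (L * _)%N in dvd1 dvd2.
set n := (m + N.+1)%N.
set P := (\prod_(_ <= _ < _) _)%N.
have dvd_last : (P %| M * (n ^ 2 + c))%N.
  by rewrite /P big_nat_recr ?leq_addr //= dvdn_mul // /n addnS.
have dvd_first : (P %| M * (m ^ 2 + c))%N.
  rewrite /P big_ltn ?ltnS ?leq_addr // mulnC dvdn_mul //.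
  by rewrite /n addnS -addSn.
(* The resultant of [X ^ 2 + c] and [(X + d) ^ 2 + c] is
   [d ^ 2 * (d ^ 2 + 4 * c)]; already [d * (d ^ 2 + 4 * c)] is the combination
   of the values at [m] and [n = m + d] with coefficients [3 * d + 2 * m] and
   [d - 2 * m]. *)
have bezout : (L * (N.+1 * N`! * (\prod_(1 <= k < N.+1) (k ^ 2 + 4 * c)
      * (N.+1 ^ 2 + 4 * c))) + 2 * m * (M * (n ^ 2 + c))
    = (3 * N.+1 + 2 * m) * (M * (m ^ 2 + c)) + N.+1 * (M * (n ^ 2 + c)))%N.
  rewrite /M /n; ring.
(* The coefficient [N.+1 - 2 * m] may be negative, so [bezout] carries its negative part on the
   left; being a multiple of [P], that term drops out. *)
rewrite -(dvdn_addl _ (dvdn_mull (2 * m) dvd_last)) bezout.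
by apply: dvdn_add; apply: dvdn_mull.
Qed.

Lemma dvdn_lcm_quad (c m n k : nat) :
  (m <= k <= n)%N -> (k ^ 2 + c %| lcm_quad c m n)%N.
Proof.
move=> /andP[mk kn]; rewrite /lcm_quad big_geq_mkord.
by apply: (biglcmn_sup (Ordinal (kn : (k < n.+1)%N))); rewrite //= mk.
Qed.

Lemma lcm_quad_gt0 (c m n : nat) : (0 < c)%N -> (0 < lcm_quad c m n)%N.
Proof.
move=> c_gt0; rewrite /lcm_quad; elim/big_ind: _ => //.
  by move=> x y x_gt0 y_gt0; rewrite lcmn_gt0 x_gt0.
by move=> k _; rewrite addn_gt0 c_gt0 orbT.
Qed.

Lemma prod_quad_dvd_lcm (c m n : nat) : (m <= n)%N ->
  (\prod_(m <= k < n.+1) (k ^ 2 + c) %| lcm_quad c m n *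
     ((n - m)`! * \prod_(1 <= k < (n - m).+1) (k ^ 2 + 4 * c)))%N.
Proof.
move=> lemn; rewrite -{1}(subnKC lemn); apply: prod_quad_dvd => k.
by rewrite subnKC //; apply: dvdn_lcm_quad.
Qed.

Lemma prod_nat_gt0 (F : nat -> nat) (a b : nat) :
  (forall k, (a <= k < b)%N -> (0 < F k)%N) -> (0 < \prod_(a <= k < b) F k)%N.
Proof. by move=> F_gt0; rewrite big_nat; apply: prodn_cond_gt0. Qed.

(** Dropping [c] from every factor leaves the product of the [k ^ 2], which is the square of
    [m * n! / m!]. *)
Lemma sqr_fact_le_prod_quad (c m n : nat) : (0 < m <= n)%N ->
  (m ^ 2 * n`! ^ 2 <= m`! ^ 2 * \prod_(m <= k < n.+1) (k ^ 2 + c))%N.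
Proof.
move=> /andP[m_gt0 lemn]; rewrite -(subnKC lemn).
elim: (n - m)%N => [|d IHd].
  by rewrite addn0 big_nat1; nia.
rewrite addnS factS big_nat_recr /=; last by lia.
set P := (\prod_(_ <= _ < _) _)%N in IHd *.
rewrite expnMn mulnCA mulnC mulnA leq_mul //; lia.
Qed.

Section RealBounds.
Import numFieldNormedType.Exports.
Variable R : realType.
Implicit Type x : R.

Lemma sin_le_id x : 0 <= x -> sin x <= x.
Proof.
move=> x_ge0.
have [|y _] := @MVT_segment R sin cos 0 x x_ge0.
  by apply: continuous_subspaceT; apply: continuous_sin.
rewrite sin0 !subr0 => ->.
by rewrite -[leRHS]mul1r ler_wpM2r // cos_le1.
Qed.

(** Since [cos (pi / 2) = 0], the double angle formula gives [sin (pi / 4) ^+ 2 = 1 / 2], and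
    [sin x <= x] bounds this by [pi ^+ 2 / 16]. *)
Lemma pi_sqr_ge8 : 8 <= (pi : R) ^+ 2.
Proof.
have cosE : cos (pi / 2 : R) = 1 - sin (pi / 4) ^+ 2 *+ 2.
  have -> : pi / 2 = (pi / 4) *+ 2 :> R by field.
  by rewrite cos_mulr2n cos2sin2; ring.
have pi0 : 0 <= pi / 4 :> R by rewrite divr_ge0 // pi_ge0.
have sin0 : 0 <= sin (pi / 4 : R).
  by apply: sin_ge0_pi; rewrite pi0 /=; have := pi_ge0 R; lra.
have := sin_le_id pi0; rewrite cos_pihalf in cosE; nra.
Qed.

(* [4 c / k ^ 2 <= 4 c (1 / (k - 1 / 2) - 1 / (k + 1 / 2))] telescopes. *)
Lemma prod_quad4_le (c N : nat) :
  (\prod_(1 <= k < N.+2) (k ^ 2 + 4 * c))%N%:R <=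
  N.+1`!%:R ^+ 2 * ((1 + 4 * c%:R) *
     expR (4 * c%:R * (2 / 3 - 2 / (2 * N%:R + 3)))) :> R.
Proof.
have c_ge0 : 0 <= c%:R :> R by [].
elim: N => [|N IHN].
  rewrite big_nat1 mulr0 add0r subrr mulr0 expR0 expr1n mulr1 mul1r.
  by rewrite natrD natrM.
have N_ge0 : 0 <= N%:R :> R by [].
have N2E : N.+2%:R = N%:R + 2 :> R by rewrite -natrD addn2.
have factE : N.+2`!%:R = (N%:R + 2) * N.+1`!%:R :> R.
  by rewrite [N.+2`!]factS natrM N2E.
rewrite big_nat_recr // factE natrM natrD natrX natrM N2E.
set t := N%:R : R in N_ge0 IHN *.
have tE : N.+1%:R = t + 1 :> R by rewrite -natr1.
pose d : R := 2 / (2 * t + 3) - 2 / (2 * t + 5).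
(* The new index is [k = t + 2], and [k ^ 2 * d >= 1] because
   [(2 * k - 1) * (2 * k + 1) <= 4 * k ^ 2]; then [1 + y <= expR y] applies. *)
have step : (t + 2) ^+ 2 + 4 * c%:R <= (t + 2) ^+ 2 * expR (4 * c%:R * d).
  apply: le_trans (ler_wpM2l (sqr_ge0 _) (expR_ge1Dx _)).
  rewrite mulrDr mulr1 lerD2l.
  have -> : (t + 2) ^+ 2 * (4 * c%:R * d) = 4 * c%:R * ((t + 2) ^+ 2 * d).
    by ring.
  rewrite -[leLHS]mulr1 ler_wpM2l ?mulr_ge0 //.
  have -> : (t + 2) ^+ 2 * d =
      (4 * (t + 2) ^+ 2) / ((2 * t + 3) * (2 * t + 5)).
    by rewrite /d; field; rewrite !gt_eqF //; lra.
  by rewrite ler_pdivlMr; nra.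
have -> : 2 / 3 - 2 / (2 * N.+1%:R + 3) = (2 / 3 - 2 / (2 * t + 3)) + d.
  by rewrite /d tE; field; rewrite !gt_eqF //; lra.
rewrite [_ * (_ + d)]mulrDr expRD exprMn.
apply: le_trans (ler_pM _ _ IHN step) _ => //.
  by rewrite addr_ge0 ?sqr_ge0 ?mulr_ge0.
by rewrite le_eqVlt; apply/orP; left; apply/eqP; ring.
Qed.

(** The first factor and the telescoped tail each cost at most [expR (8 / 3 * c)], and
    [16 / 3 <= 2 * pi ^+ 2 / 3]. *)
Lemma prod_quad4_le_expR (c N : nat) : (0 < c)%N ->
  (\prod_(1 <= k < N.+1) (k ^ 2 + 4 * c))%N%:R <=
  N`!%:R ^+ 2 * expR (2 * pi ^+ 2 / 3 * c%:R) :> R.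
Proof.
move=> c_gt0; have c_ge1 : 1 <= c%:R :> R by rewrite ler1n.
have pi8 := pi_sqr_ge8.
case: N => [|N].
  rewrite big_geq // expr1n mul1r.
  by apply: le_trans (expR_ge1Dx _); rewrite lerDl !mulr_ge0 ?(pi_ge0, invr_ge0).
apply: le_trans (prod_quad4_le c N) _.
rewrite ler_wpM2l ?sqr_ge0 //.
have N_ge0 : 0 <= N%:R :> R by [].
have q0 : 0 <= 2 / (2 * N%:R + 3) :> R by rewrite divr_ge0 //; lra.
(* Bounding [1 + 4 * c] by [expR (4 * c)] would be too weak, as it would require [10 <= pi ^+ 2].
   Squaring [1 + x <= expR x] gains enough, since [1 + 4 * c <= (1 + x) ^ 2] for [1 <= c]. *)
pose x : R := 4 / 3 * c%:R.
have le1 : 1 + 4 * c%:R <= expR x * expR x.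
  have ex := expR_ge1Dx x; apply: (@le_trans _ _ ((1 + x) * (1 + x))).
    by rewrite /x; nra.
  by apply: ler_pM => //; rewrite /x; lra.
apply: (@le_trans _ _ (expR x * expR x * expR (8 / 3 * c%:R))).
  apply: ler_pM => //; [lra | exact: expR_ge0 | by rewrite ler_expR; nra].
by rewrite -!expRD ler_expR /x; nra.
Qed.

End RealBounds.

Theorem theorem4 (R : realType) (c m n : nat)
    (hc : (0 < c)%N) (hm : (0 < m)%N) (hn : (0 < n)%N) (hmn : (m <= n)%N) :
  multiple_of_rat (lcm_quad c m n)%:Z
    ((\prod_(m <= k < n.+1) (k ^ 2 + c))%N%:R /
     (c * (n - m)`! * \prod_(1 <= k < (n - m).+1) (k ^ 2 + 4 * c))%N%:R)
  /\
  (lcm_quad c m n)%:R >=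
    lambda1 R c * (m%:R ^+ 2 *
      (n`!%:R ^+ 2 / (m`!%:R ^+ 2 * (n - m)`!%:R ^+ 3))).
Proof.
have dvdL := prod_quad_dvd_lcm c hmn.
have factP := sqr_fact_le_prod_quad c (introT andP (conj hm hmn)).
have D_le := prod_quad4_le_expR R (n - m) hc.
have L_gt0 := lcm_quad_gt0 m n hc.
have P_gt0 : (0 < \prod_(m <= k < n.+1) (k ^ 2 + c))%N.
  by apply: prod_nat_gt0 => k _; rewrite addn_gt0 hc orbT.
have D_gt0 : (0 < \prod_(1 <= k < (n - m).+1) (k ^ 2 + 4 * c))%N.
  by apply: prod_nat_gt0 => k _; rewrite addn_gt0 muln_gt0 hc orbT.
set L := lcm_quad c m n in dvdL L_gt0 *.
set P := (\prod_(_ <= _ < n.+1) _)%N in dvdL factP P_gt0 *.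
set D := (\prod_(1 <= _ < _) _)%N in dvdL D_le D_gt0 *.
set F := (n - m)`! in dvdL D_le *.
have F_gt0 : (0 < F)%N by apply: fact_gt0.
split.
  have Pn0 : P%:R != 0 :> rat by rewrite pnatr_eq0 -lt0n.
  have cFDn0 : (c * F * D)%:R != 0 :> rat.
    by rewrite pnatr_eq0 -lt0n !muln_gt0 hc F_gt0.
  split; first by rewrite mulf_neq0 ?invr_eq0.
  have [q Eq] := dvdnP dvdL.
  (* With [L * (F * D) = q * P], the quotient is the integer [c * q]. *)
  suff -> : L%:Z%:~R / (P%:R / (c * F * D)%:R) = (c * q)%:R :> rat.
    exact: natr_int.
  have Eq' : (L%:R * (F%:R * D%:R) = q%:R * P%:R :> rat).
    by rewrite -!natrM Eq.
  rewrite -pmulrn invf_div mulrA; apply: (canLR (mulfK Pn0)).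
  by rewrite !natrM -!mulrA -Eq'; ring.
set E := expR _ in D_le.
have lbE : lambda1 R c = E^-1 / c%:R by rewrite /lambda1 mulNr expRN.
have E_gt0 : 0 < E by apply: expR_gt0.
have c_ge1 : 1 <= c%:R :> R by rewrite ler1n.
have c_gt0 : 0 < c%:R :> R by rewrite ltr0n.
have F_gt0' : 0 < F%:R :> R by rewrite ltr0n.
have m_gt0 : 0 < m`!%:R :> R by rewrite ltr0n fact_gt0.
(* As [L * (F * D)] is positive, divisibility by [P] becomes an inequality; bounding [D] by
   [F ^ 2 * E] produces the cube of [F]. *)
have P_le : P%:R <= L%:R * (F%:R * D%:R) :> R.
  by rewrite -!natrM ler_nat dvdn_leq // !muln_gt0 L_gt0 F_gt0.
have P_le' : P%:R <= L%:R * (F%:R ^+ 3 * E) :> R.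
  apply: le_trans P_le _; rewrite ler_wpM2l //.
  by rewrite exprS -mulrA ler_wpM2l.
have factP' : m%:R ^+ 2 * n`!%:R ^+ 2 <= m`!%:R ^+ 2 * P%:R :> R.
  by rewrite -!natrX -!natrM ler_nat.
have -> : lambda1 R c * (m%:R ^+ 2 *
      (n`!%:R ^+ 2 / (m`!%:R ^+ 2 * F%:R ^+ 3))) =
    (m%:R ^+ 2 * n`!%:R ^+ 2) / (c%:R * (m`!%:R ^+ 2 * (F%:R ^+ 3 * E))).
  by rewrite lbE; field; rewrite !gt_eqF //; lra.
rewrite ler_pdivrMr ?(mulr_gt0, exprn_gt0) //.
apply: le_trans factP' _.
have X_ge0 : 0 <= m`!%:R ^+ 2 * (L%:R * (F%:R ^+ 3 * E)) :> R.
  by rewrite !mulr_ge0 ?exprn_ge0 // ltW.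
apply: le_trans (ler_wpM2l (sqr_ge0 _) P_le') _.
have -> : L%:R * (c%:R * (m`!%:R ^+ 2 * (F%:R ^+ 3 * E)))
  = c%:R * (m`!%:R ^+ 2 * (L%:R * (F%:R ^+ 3 * E))) :> R by ring.
by rewrite ler_peMl.
Qed.
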